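(* Let $\mathcal{C}$ be a symmetric class of subsets of $\{1,\dots,n\}$, all of the same cardinality $|S|\ge 1$, let $m>0$, $\mu>0$, $\varepsilon>0$, and suppose $1+\sqrt2\le(1-2\varepsilon)\log(|\mathcal{C}|-1)$. If $$\mu^2\le(1-2\varepsilon)\frac{n}{2|S|m}\log(|\mathcal{C}|-1) ,$$ then no non-adaptive procedure (with precision budget $m$) can have $$\mathbb{P}_S(\hat S\neq S)\le\varepsilon\qquad\text{for all }S\in\mathcal{C} .$$
   Context: A class $\mathcal{C}$ of subsets of $\{1,\dots,n\}$ of cardinality $s$ is symmetric if, for $S$ drawn uniformly at random from $\mathcal{C}$, $\mathbb{P}(i\in S)=s/n$ for every $i$. Non-adaptive sensing model. For an unknown $S\in\mathcal{C}$, the signal $\boldsymbol{x}\in\mathbb{R}^n$ has $x_i=\mu$ if $i\in S$ and $x_i=0$ otherwise. Measurements are $Y_j=x_{A_j}+\Gamma_j^{-1/2}W_j$, $j=1,2,\dots$, with $W_j$ i.i.d. $\mathcal{N}(0,1)$, $A_j\in\{1,\dots,n\}$, $\Gamma_j>0$, where $\{A_j,\Gamma_j\}_j$ are chosen before any observation is collected (independently of the noise and of $S$), subject to the precision budget $\mathbb{E}\big(\sum_j\Gamma_j\big)\le m$. An estimator $\hat S$ is a function of $\{Y_j,A_j,\Gamma_j\}_j$. A non-adaptive procedure consists of such a choice of $\{A_j,\Gamma_j\}_j$ and an estimator. $\mathbb{P}_S$ is the probability when the support is $S$. *)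

(* Defs.v *)
From HB Require Import structures.
From mathcomp Require Import all_boot all_order all_algebra finmap.
From mathcomp Require Import all_classical all_reals all_analysis.

Set Implicit Arguments.
Unset Strict Implicit.
Unset Printing Implicit Defensive.

Import Order.TTheory GRing.Theory Num.Theory.
Import numFieldNormedType.Exports.

Local Open Scope classical_set_scope.
Local Open Scope ring_scope.

(* The uniform law on a nonempty finite class, evaluated on an event. *)
Definition unif_prob (n : nat) (C : {set {set 'I_n}})
    (E : pred {set 'I_n}) : rat :=
  #|[set S in C | E S]%SET|%:R / #|C|%:R.

Record symmetric_class (n s : nat) (C : {set {set 'I_n}}) : Prop := {
  symmetric_class_neq0 : (0 < #|C|)%N ;
  symmetric_class_card : forall S, S \in C -> #|S| = s ;
  symmetric_class_unif :
    forall i : 'I_n, unif_prob C (fun S => i \in S) = s%:R / n%:R }.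

Definition signal (R : realType) (n : nat) (mu : R) (S : {set 'I_n})
    (i : 'I_n) : R :=
  if i \in S then mu else 0.

(* A full record of the experiment: the j-th entry is (Y_j, A_j, Gamma_j),
   counting measurements from j = 0. *)
Definition record (R : realType) (n : nat) : Type := nat -> R * 'I_n * R.

(* The product sigma-algebra on records, 'I_n being discrete. *)
Definition record_sigma (R : realType) (n : nat) : set (set (record R n)) :=
  <<s \bigcup_j
      (preimage_set_system setT (fun o : record R n => (o j).1.1) measurable
       `|` preimage_set_system setT (fun o : record R n => (o j).1.2)
             (@discrete_measurable 'I_n)
       `|` preimage_set_system setT (fun o : record R n => (o j).2)
             measurable) >>.

Definition estimator (R : realType) (n : nat)
    (Shat : record R n -> {set 'I_n}) : Prop :=
  forall S : {set 'I_n}, @record_sigma R n (Shat @^-1` [set S]).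

Section Sensing.
Context {d : measure_display} {T : measurableType d} {R : realType}.
Variable P : probability T R.

Definition mutually_independent (W : nat -> {RV P >-> R}) : Prop :=
  forall (J : {fset nat}) (B : nat -> set R),
    (forall j, measurable (B j)) ->
    P (\bigcap_(j in [set` J]) (W j @^-1` B j))
      = (\prod_(j <- J) P (W j @^-1` B j))%E.

Definition iid_standard_normal (W : nat -> {RV P >-> R}) : Prop :=
  mutually_independent W /\
  forall (j : nat) (B : set R), measurable B ->
    distribution P (W j) B = normal_prob 0 1 B.

Definition noise_sigma (W : nat -> {RV P >-> R}) : set (set T) :=
  <<s \bigcup_j preimage_set_system setT (W j) measurable >>.

Definition design_sigma (n : nat) (A : nat -> T -> 'I_n)
    (G : nat -> {RV P >-> R}) : set (set T) :=
  <<s \bigcup_j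
      (preimage_set_system setT (A j) (@discrete_measurable 'I_n)
       `|` preimage_set_system setT (G j) measurable) >>.

(* A possibly random choice of locations A_j and precisions G_j. The support
   is not a random element here, and A and G do not mention it, so that the
   design is the same whatever the support. *)
Record nonadaptive_design (n : nat) (m : R) (W : nat -> {RV P >-> R})
    (A : nat -> T -> 'I_n) (G : nat -> {RV P >-> R}) : Prop := {
  design_measurable : forall j i, measurable (A j @^-1` [set i]) ;
  design_precision_gt0 : forall j w, 0 < G j w ;
  design_indep_noise : forall E F : set T,
    design_sigma A G E -> noise_sigma W F -> P (E `&` F) = (P E * P F)%E ;
  design_budget :
    (\int[P]_w (\sum_(0 <= j <oo) (G j w)%:E) <= m%:E)%E }.

Definition observation (n : nat) (mu : R) (S : {set 'I_n})
    (W : nat -> {RV P >-> R}) (A : nat -> T -> 'I_n)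
    (G : nat -> {RV P >-> R}) (w : T) : record R n :=
  fun j => (signal mu S (A j w) + G j w `^ (- 2^-1) * W j w, A j w, G j w).

(* P_S (Shat <> S): the data are generated with support S from the common
   noise and design. *)
Definition error_prob (n : nat) (mu : R) (W : nat -> {RV P >-> R})
    (A : nat -> T -> 'I_n) (G : nat -> {RV P >-> R})
    (Shat : record R n -> {set 'I_n}) (S : {set 'I_n}) : \bar R :=
  P [set w | Shat (observation mu S W A G w) <> S].

End Sensing.

(* Main.v *)
Require Import Defs.
From HB Require Import structures.
From mathcomp Require Import all_boot all_order all_algebra finmap.
From mathcomp Require Import all_classical all_reals all_analysis.
From mathcomp Require Import measurable_realfun.
From mathcomp Require Import ring lra.

Set Implicit Arguments.
Unset Strict Implicit.
Unset Printing Implicit Defensive.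

Import Order.TTheory GRing.Theory Num.Theory.
Import numFieldNormedType.Exports.

Local Open Scope classical_set_scope.
Local Open Scope ring_scope.

(** Testing each S in the class against the null signal: under the signal S the
    log-likelihood ratio Lambda of the first k records satisfies, for every
    event E, the pointwise bound x <= exp x - 1 with x = a 1_E - Lambda, and
    integrating it gives
      a P_S(E) <= E_S[Lambda] + (exp a - 1) P_0(E).
    The Girsanov identity E_S[1_E exp(-Lambda)] = P_0(E) is obtained by removing
    the signal from one record at a time, the noise of that record being a
    standard normal independent of everything else; approximating events by
    events on finitely many records removes the restriction to k records.
    Summing over S with E = (Shat = S) and a = ln (N - 1), N being the size of
    the class: the null probabilities add up to at most 1, and by symmetry the
    divergences E_S[Lambda] add up to at most N s mu^2 m / (2 n), which is at
    most N (1 - 2 eps) a / 4. Hence (1 - eps) a <= (1 - 2 eps) a / 4 + 1,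
    impossible as soon as (1 - 2 eps) a >= 2. *)

(** * The standard normal law *)

Section StandardNormal.
Context {R : realType}.
Local Notation leb := (@lebesgue_measure R).
Local Notation gauss := (@normal_prob R 0 1).

Lemma normal_setT : gauss setT = 1%E.
Proof. exact: (@probability_setT _ _ _ (normal_prob 0 1)). Qed.

(** Translation preserves the lengths of half-open intervals, and these determine Lebesgue
    measure. *)
Lemma lebesgue_measure_shift (c : R) (A : set R) : measurable A ->
  pushforward leb ((fun x => x + c) : _ -> measurableTypeR R) A = leb A.
Proof.
move=> mA; apply/esym.
have mc : measurable_fun setT ((fun x => x + c) : _ -> measurableTypeR R).
  exact: measurable_funD.
apply: lebesgue_measure_unique => //= _ [[a b]] _ <-.
rewrite /pushforward /=.
rewrite (_ : _ @^-1` _ = `]a - c, b - c]%classic); last first.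
  by apply/seteqP; split => x /=; rewrite !in_itv/= ltrBlDr lerBrDr.
rewrite !lebesgue_measure_itv/= !lte_fin ltrD2r.
by case: ifP => // _; rewrite -!EFinB; congr EFin; lra.
Qed.

Lemma ge0_integral_shift (f : R -> \bar R) (c : R) :
  measurable_fun setT f -> (forall x, 0 <= f x)%E ->
  (\int[leb]_x f (x + c)%R = \int[leb]_x f x)%E.
Proof.
move=> mf f0.
have mc : measurable_fun setT ((fun x => x + c) : _ -> measurableTypeR R).
  exact: measurable_funD.
transitivity (\int[pushforward leb
    ((fun x => x + c)%R : _ -> measurableTypeR R)]_x f x)%E.
  by rewrite ge0_integral_pushforward.
by apply: eq_measure_integral => A mA _; exact: lebesgue_measure_shift.
Qed.

(** The Radon-Nikodym derivative of the normal law and [normal_pdf] have the same integral over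
    every measurable set, hence agree almost everywhere. *)
Lemma ge0_integral_normal (f : R -> \bar R) :
  measurable_fun setT f -> (forall x, 0 <= f x)%E ->
  (\int[gauss]_x f x = \int[leb]_x (f x * (normal_pdf 0 1 x)%:E))%E.
Proof.
move=> mf f0.
have dom : gauss `<< leb by exact: normal_prob_dominates.
rewrite -(Radon_Nikodym_SigmaFinite.change_of_variables dom)//.
have iRN := Radon_Nikodym_SigmaFinite.f_integrable dom.
have mpdf : measurable_fun setT (fun x : R => (normal_pdf 0 1 x)%:E).
  by apply/measurable_EFinP; exact: measurable_normal_pdf.
apply: ge0_ae_eq_integral => //.
- by apply: emeasurable_funM => //; exact: measurable_int iRN.
- exact: emeasurable_funM.
- by move=> x _; rewrite mule_ge0// Radon_Nikodym_SigmaFinite.f_ge0.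
- by move=> x _; rewrite mule_ge0// lee_fin normal_pdf_ge0.
- apply: ae_eqe_mul2l; apply: integral_ae_eq => //.
  by move=> E _ mE; rewrite -Radon_Nikodym_SigmaFinite.f_integral.
Qed.

(** One-dimensional Girsanov formula: by completing the square, the exponential factor turns the
    density at [z] into the density at [z + c]; Lebesgue measure is translation invariant. *)
Lemma ge0_integral_normal_shift (f : R -> \bar R) (c : R) :
  measurable_fun setT f -> (forall x, 0 <= f x)%E ->
  (\int[gauss]_z (f (z + c)%R * (expR (- (c * z) - c ^+ 2 / 2))%:E)
    = \int[gauss]_z f z)%E.
Proof.
move=> mf f0.
have mfc : measurable_fun setT (fun z : R => f (z + c)).
  by apply: measurableT_comp => //; exact: measurable_funD.
have mpdf : measurable_fun setT (fun x : R => (normal_pdf 0 1 x)%:E).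
  by apply/measurable_EFinP; exact: measurable_normal_pdf.
rewrite ge0_integral_normal; last 2 first.
- apply: emeasurable_funM => //; apply/measurable_EFinP.
  apply: measurableT_comp => //; apply: measurable_funB => //.
  by apply: measurableT_comp => //; exact: measurable_funM.
- by move=> z; rewrite mule_ge0// lee_fin expR_ge0.
rewrite ge0_integral_normal//.
rewrite -[RHS](@ge0_integral_shift _ c); last 2 first.
- exact: emeasurable_funM.
- by move=> z; rewrite mule_ge0// lee_fin normal_pdf_ge0.
apply: eq_integral => z _; rewrite -muleA -EFinM; congr (_ * _%:E)%E.
rewrite !normal_pdfE ?oner_eq0//= /normal_fun mulrCA -expRD; congr (_ * expR _).
by rewrite !subr0; field.
Qed.

(** The shift formula for [- c], applied to the constant [expR (c ^+ 2 / 2)]. *)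
Lemma integral_normal_expR (c : R) :
  (\int[gauss]_z (expR (c * z))%:E = (expR (c ^+ 2 / 2))%:E)%E.
Proof.
transitivity (\int[gauss]_z cst (expR (c ^+ 2 / 2))%:E z)%E; last first.
  by rewrite integral_cst// -[RHS]mule1; congr (_ * _)%E; exact: normal_setT.
rewrite -[RHS](@ge0_integral_normal_shift _ (- c))//; last first.
  by move=> x; rewrite lee_fin expR_ge0.
apply: eq_integral => z _ /=; rewrite -EFinM -expRD; congr (expR _)%:E.
by rewrite sqrrN; ring.
Qed.

Lemma measurable_expR_scale (c : R) :
  measurable_fun setT (fun z : R => (expR (c * z))%:E).
Proof.
by apply/measurable_EFinP/measurableT_comp => //; exact: measurable_funM.
Qed.

Lemma integrable_normal_expR (c : R) :
  gauss.-integrable setT (fun z : R => (expR (c * z))%:E).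
Proof.
apply/integrableP; split; first exact: measurable_expR_scale.
under eq_integral do rewrite gee0_abs ?lee_fin ?expR_ge0//.
by rewrite integral_normal_expR ltry.
Qed.

(** Domination by [expR z + expR (- z)]. *)
Lemma integrable_normal_id : gauss.-integrable setT (fun z : R => z%:E).
Proof.
apply: (le_integrable _ _ _
  (integrableD _ (integrable_normal_expR 1) (integrable_normal_expR (- 1)))) =>
    //.
  exact/measurable_EFinP.
move=> z _ /=; rewrite lee_fin [leRHS]ger0_norm ?addr_ge0 ?expR_ge0//.
rewrite !(mul1r, mulN1r) ler_norml.
have := expR_ge1Dx z; have := expR_ge1Dx (- z).
by have := expR_ge0 z; have := expR_ge0 (- z); lra.
Qed.

(* Compare [1 + c z <= expR (c z)] with the moment generating function
   [expR (c^2 / 2)] and let [c] tend to 0 from both sides. *)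
Lemma integral_normal_id : (\int[gauss]_z z%:E = 0)%E.
Proof.
have [m im] : exists m : R, (\int[gauss]_z z%:E = m%:E)%E.
  by exists (fine (\int[gauss]_z z%:E)%E); rewrite fineK// integrable_fin_num//;
    exact: integrable_normal_id.
have mgf c : 1 + c * m <= expR (c ^+ 2 / 2).
  rewrite -lee_fin -integral_normal_expR.
  have -> : (1 + c * m)%:E = (\int[gauss]_z (1%:E + c%:E * z%:E))%E.
    rewrite integralD//; last 2 first.
    - exact: finite_measure_integrable_cst.
    - by apply: integrableZl => //; exact: integrable_normal_id.
    rewrite integral_cst// (_ : (1%:E * _ = 1)%E); last first.
      by rewrite mul1e; exact: normal_setT.
    by rewrite integralZl//; [rewrite im|exact: integrable_normal_id].
  apply: le_integral => //.
  - apply: integrableD => //; first exact: finite_measure_integrable_cst.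
    by apply: integrableZl => //; exact: integrable_normal_id.
  - exact: integrable_normal_expR.
  - by move=> z _; rewrite -EFinM -EFinD lee_fin expR_ge1Dx.
(* With [x = c ^+ 2 <= 1], one has [expR (x / 2) <= 1 / (1 - x / 2) <= 1 + x]. *)
have small c : `|c| <= 1 -> c * m <= c ^+ 2.
  move=> c1; have c2 : c ^+ 2 <= 1 by rewrite -real_normK ?num_real// expr_le1.
  have := expR_ge1Dx (- (c ^+ 2 / 2)); rewrite expRN => eN.
  have e0 := expR_gt0 (c ^+ 2 / 2).
  have := mgf c; set e := expR _ in eN e0 * => ecm.
  have : (1 - c ^+ 2 / 2) * e <= 1.
    by rewrite -[leRHS](mulVf (lt0r_neq0 e0))// ler_pM2r.
  have := sqr_ge0 c; set x := c ^+ 2 in c2 * => x0 xe.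
  rewrite leNgt; apply/negP => xm.
  have : (1 - x / 2) * (1 + x) < (1 - x / 2) * e.
    by rewrite ltr_pM2l; lra.
  nra.
rewrite im {im}; congr EFin; apply/eqP; rewrite eq_le; apply/andP; split.
(* For this [c], [small] would give [m <= c <= m / 2]. *)
- rewrite leNgt; apply/negP => m0; pose c := Num.min 1 (m / 2).
  have c0 : 0 < c by rewrite lt_min ltr01 divr_gt0.
  have cm : c <= m / 2 by rewrite ge_min lexx orbT.
  have /small : `|c| <= 1 by rewrite gtr0_norm// ge_min lexx.
  by rewrite expr2 ler_pM2l// => mc; lra.
- rewrite leNgt; apply/negP => m0; pose c := Num.min 1 (- m / 2).
  have c0 : 0 < c by rewrite lt_min ltr01 divr_gt0// oppr_gt0.
  have cm : c <= - m / 2 by rewrite ge_min lexx orbT.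
  have /small : `|- c| <= 1 by rewrite normrN gtr0_norm// ge_min lexx.
  by rewrite sqrrN mulNr -mulrN expr2 ler_pM2l// => mc; lra.
Qed.

End StandardNormal.

(** * One independent standard normal coordinate *)

Section IndependentNoise.
Context d (T : measurableType d) (R : realType) (P : probability T R).
Variables (F : set (set T)) (Z : T -> R).
Hypothesis subF : F `<=` measurable.
Hypothesis mZ : measurable_fun setT Z.
Hypothesis indepFZ : forall E B, <<s F >> E -> measurable B ->
  P (E `&` Z @^-1` B) = (P E * normal_prob 0 1 B)%E.

Local Notation TF := (g_sigma_algebraType F).
Local Notation gauss := (@normal_prob R 0 1).

Lemma sub_sigmaF : <<s F >> `<=` measurable.
Proof.
exact: smallest_sub (@sigma_algebra_measurable _ T) subF.
Qed.

Lemma measurable_sigmaF d' (T' : measurableType d') (f : TF -> T') :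
  measurable_fun setT f -> measurable_fun setT (f : T -> T').
Proof. by move=> mf _ B mB; apply: sub_sigmaF; exact: mf. Qed.

Lemma measurable_sigmaF_pair :
  measurable_fun setT (fun w : T => (w : TF, Z w)).
Proof.
by apply: measurable_fun_pair => //; apply: measurable_sigmaF;
  exact: measurable_id.
Qed.

(** The joint law of the point, seen through the sigma-algebra generated by [F], and of [Z] is a
    product measure, by agreement on rectangles; Tonelli then integrates [Z] out first. *)
Lemma ge0_integral_indep (f : TF * R -> \bar R) :
  measurable_fun setT f -> (forall x, 0 <= f x)%E ->
  (\int[P]_w f (w : TF, Z w) = \int[P]_w \int[gauss]_z f (w : TF, z))%E.
Proof.
move=> mf f0.
have mid : measurable_fun setT (fun w : T => w : TF).
  by apply: measurable_sigmaF; exact: measurable_id.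
pose X : {mfun T >-> TF} := HB.pack (fun w : T => w : TF)
  (isMeasurableFun.Build _ _ _ _ _ mid).
pose XZ : {mfun T >-> (TF * R)%type} := HB.pack (fun w : T => (w : TF, Z w))
  (isMeasurableFun.Build _ _ _ _ _ measurable_sigmaF_pair).
(* The identity [tR] only transports the normal law from [measurableTypeR R] to [R]. *)
have mtR : measurable_fun setT (fun z : measurableTypeR R => z : R) by [].
pose tR : {mfun measurableTypeR R >-> R} := HB.pack
  (fun z : measurableTypeR R => z : R) (isMeasurableFun.Build _ _ _ _ _ mtR).
pose gaussR := distribution gauss tR.
have XZE B : measurable B ->
    (distribution P X \x gaussR)%E B = distribution P XZ B.
  have := @product_measure_unique _ _ _ _ _ (distribution P X) gaussR
    (distribution P XZ).
  by apply => E C mE mC; exact: indepFZ.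
transitivity (\int[distribution P XZ]_x f x)%E.
  by rewrite ge0_integral_pushforward.
transitivity (\int[(distribution P X \x gaussR)%E]_x f x)%E.
  by apply: eq_measure_integral => B mB _; exact/esym/XZE.
rewrite fubini_tonelli1// ge0_integral_pushforward//; last 2 first.
- exact: measurable_fun_fubini_tonelli_F.
- by move=> w _; apply: integral_ge0.
apply: eq_integral => w _.
have mfw : measurable_fun setT (fun z : R => f (w : TF, z)).
  exact: measurableT_comp.
exact: (ge0_integral_pushforward mtR gauss measurableT mfw (fun z _ => f0 _)).
Qed.

(** Given the information in [F], the shift [c] is a constant, so the one-dimensional formula
    applies under the outer integral. *)
Lemma ge0_integral_indep_shift (f : TF * R -> \bar R) (c : TF -> R) :
  measurable_fun setT f -> (forall x, 0 <= f x)%E -> measurable_fun setT c ->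
  (\int[P]_w (f (w : TF, Z w + c w)%R
      * (expR (- (c w * Z w) - c w ^+ 2 / 2))%:E)
    = \int[P]_w f (w : TF, Z w))%E.
Proof.
move=> mf f0 mc.
have mc1 : measurable_fun setT (fun x : TF * R => c x.1).
  exact: measurableT_comp.
rewrite (@ge0_integral_indep (fun x => f (x.1, (x.2 + c x.1)%R)
   * (expR (- (c x.1 * x.2) - c x.1 ^+ 2 / 2))%:E)%E); first last.
- by move=> x; rewrite mule_ge0// lee_fin expR_ge0.
- apply: emeasurable_funM.
    apply: measurableT_comp => //; apply: measurable_fun_pair => //.
    exact: measurable_funD.
  apply/measurable_EFinP; apply: measurableT_comp => //.
  apply: measurable_funB; first by apply: measurableT_comp => //;
    exact: measurable_funM.
  by apply: measurable_funM => //; exact: measurable_funX.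
rewrite [RHS]ge0_integral_indep//; apply: eq_integral => w _.
have mfw : measurable_fun setT (fun z : R => f (w : TF, z)).
  exact: measurableT_comp.
by rewrite -[RHS](ge0_integral_normal_shift (c w) mfw).
Qed.

Lemma measurable_indepM (c : TF -> R) : measurable_fun setT c ->
  measurable_fun setT (fun x : TF * R => (c x.1 * x.2)%:E).
Proof.
move=> mc; apply/measurable_EFinP; apply: measurable_funM => //.
exact: measurableT_comp.
Qed.

(** By Tonelli the absolute moment of the product factors. *)
Lemma integrable_indepM (c : TF -> R) :
  measurable_fun setT c -> P.-integrable setT (fun w => (c w)%:E) ->
  P.-integrable setT (fun w => (c w * Z w)%:E).
Proof.
move=> mc ic; apply/integrableP; split.
  by apply/measurable_EFinP; apply: measurable_funM => //;
    exact: measurable_sigmaF.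
have mabs := measurableT_comp (@abse_measurable R setT) (measurable_indepM mc).
rewrite (@ge0_integral_indep (fun x => `|(c x.1 * x.2)%:E|%E))//.
have mid : measurable_fun setT (fun z : R => `|z%:E|%E).
  by apply: measurableT_comp => //; exact/measurable_EFinP.
have sect w : (\int[gauss]_z `|(c w * z)%:E|
    = `|(c w)%:E| * \int[gauss]_z `|z%:E|)%E.
  under eq_integral do rewrite EFinM abseM.
  exact: (@ge0_integralZl _ _ _ gauss _ measurableT _ mid _
    (fun z _ => abse_ge0 _) (abse_ge0 _)).
under eq_integral do rewrite /= sect.
have /integrableP[_ idlt] := @integrable_normal_id R.
have id0 : (0 <= \int[gauss]_z `|z%:E|)%E by exact: integral_ge0.
rewrite ge0_integralZr//; last first.
  by apply: measurableT_comp => //; exact: measurable_int ic.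
have c0 : (0 <= \int[P]_w `|(c w)%:E|)%E by exact: integral_ge0.
by apply: lte_mul_pinfty; rewrite // ge0_fin_numE//; case/integrableP : ic.
Qed.

(** The mean of [a * z] is 0. Stated on the two parts, this combines with the Tonelli formula, which
    concerns nonnegative integrands. *)
Lemma integral_normalM_funepos_funeneg (a : R) :
  (\int[gauss]_z ((fun y => (a * y)%:E)^\+ z)
    = \int[gauss]_z ((fun y => (a * y)%:E)^\- z))%E.
Proof.
have ia : gauss.-integrable setT (fun y : R => (a * y)%:E).
  by under eq_fun do rewrite EFinM; apply: integrableZl => //;
    exact: integrable_normal_id.
have : (\int[gauss]_z (a * z)%:E = 0)%E.
  under eq_integral do rewrite EFinM.
  by rewrite integralZl ?integral_normal_id ?mule0//;
    exact: integrable_normal_id.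
rewrite integralE => /eqP; rewrite sube_eq ?add0e; last 2 first.
- by apply: integrable_fin_num => //; exact: integrable_funepos.
- by rewrite fin_num_adde_defr.
by move/eqP.
Qed.

Lemma integral_indepM (c : TF -> R) :
  measurable_fun setT c -> P.-integrable setT (fun w => (c w)%:E) ->
  (\int[P]_w (c w * Z w)%:E = 0)%E.
Proof.
move=> mc ic; have icZ := integrable_indepM mc ic.
have mcZ := measurable_indepM mc.
rewrite integralE.
have pos := ge0_integral_indep (measurable_funepos mcZ) (funepos_ge0 _).
have neg := ge0_integral_indep (measurable_funeneg mcZ) (funeneg_ge0 _).
have -> : (\int[P]_w ((fun w => (c w * Z w)%:E)^\+ w)
    = \int[P]_w ((fun w => (c w * Z w)%:E)^\- w))%E.
  rewrite (funepos_comp (fun x : TF * R => (c x.1 * x.2)%:E) (fun w =>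
    (w, Z w))).
  rewrite (funeneg_comp (fun x : TF * R => (c x.1 * x.2)%:E) (fun w =>
    (w, Z w))).
  rewrite [LHS]pos [RHS]neg; apply: eq_integral => w _.
  have := integral_normalM_funepos_funeneg (c w).
  rewrite (funepos_comp (fun x : TF * R => (c x.1 * x.2)%:E) (pair (w : TF))).
  by rewrite (funeneg_comp (fun x : TF * R => (c x.1 * x.2)%:E)
    (pair (w : TF))).
by rewrite subee//; apply: integrable_fin_num => //; exact: integrable_funeneg.
Qed.

End IndependentNoise.

(** * Independence of one noise from the design and the other noises *)

Section ExcludedNoise.
Context d (T : measurableType d) (R : realType) (P : probability T R).
Context (n : nat) (W G : nat -> {RV P >-> R}) (A : nat -> T -> 'I_n).

Definition design_gen : set (set T) :=
  \bigcup_j (preimage_set_system setT (A j) (@discrete_measurable 'I_n)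
             `|` preimage_set_system setT (G j) measurable).

Definition rest_gen (r : nat) : set (set T) :=
  design_gen
  `|` \bigcup_(j in [set j | j != r]) preimage_set_system setT (W j) measurable.

Definition cofinite_cylinder (B : nat -> set R) : Prop :=
  (forall j, measurable (B j)) /\ exists k, forall j, (k <= j)%N -> B j = setT.

(** A pi-system containing [rest_gen r], on which probabilities factor explicitly. Coordinate [r] is
    left free to receive any condition on the [r]-th noise. *)
Definition rest_cylinders (r : nat) : set (set T) :=
  [set X | exists D B, [/\ design_sigma A G D, cofinite_cylinder B, B r = setT
    & X = D `&` \bigcap_j (W j @^-1` B j)]].

Hypothesis mA : forall j i, measurable (A j @^-1` [set i]).
Hypothesis iidW : iid_standard_normal W.
Hypothesis indepAGW : forall E F : set T,
  design_sigma A G E -> noise_sigma W F -> P (E `&` F) = (P E * P F)%E.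

Lemma measurable_preimage_loc j (X : set 'I_n) : measurable (A j @^-1` X).
Proof.
have -> : A j @^-1` X = \bigcup_(i in X) (A j @^-1` [set i]).
  by apply/seteqP; split => [w Xw|w [i Xi /= ->]]; [exists (A j w)|].
exact: fin_bigcup_measurable.
Qed.

Lemma measurable_preimage_noise j (B : set R) :
  measurable B -> measurable (W j @^-1` B).
Proof.
by move=> mB; rewrite -[X in measurable X]setTI; exact: measurable_funP.
Qed.

Lemma measurable_design_gen : design_gen `<=` measurable.
Proof.
move=> _ [j _ [[B mB <-]|[B mB <-]]].
  by rewrite setTI; exact: measurable_preimage_loc.
exact: measurable_funP.
Qed.

Lemma measurable_rest_gen r : rest_gen r `<=` measurable.
Proof.
move=> X [/measurable_design_gen//|[j _ [B mB <-]]].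
exact: measurable_funP.
Qed.

Lemma measurable_design_sigma : design_sigma A G `<=` measurable.
Proof. exact: smallest_sub (@sigma_algebra_measurable _ T)
  measurable_design_gen. Qed.

Lemma noise_sigma_cylinder (B : nat -> set R) : (forall j, measurable (B j)) ->
  noise_sigma W (\bigcap_j (W j @^-1` B j)).
Proof.
move=> mB.
pose TW := g_sigma_algebraType
  (\bigcup_j preimage_set_system setT (W j) measurable).
apply: (@bigcapT_measurable _ TW) => j; apply: sub_sigma_algebra.
by exists j => //; exists (B j) => //; rewrite setTI.
Qed.

(** Independence of design and noise splits off [D]; mutual independence then applies to the
    coordinates below [k], the others being unconstrained. *)
Lemma design_noise_cylinderE (D : set T) (B : nat -> set R) k :
  design_sigma A G D -> (forall j, measurable (B j)) ->
  (forall j, (k <= j)%N -> B j = setT) ->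
  P (D `&` \bigcap_j (W j @^-1` B j))
    = (P D * \prod_(j < k) P (W j @^-1` B j))%E.
Proof.
move=> sD mB Bk; rewrite indepAGW//; last exact: noise_sigma_cylinder.
congr (_ * _)%E.
have -> : \bigcap_j (W j @^-1` B j)
    = \bigcap_(j in [set` [fset j | j in iota 0 k]%fset]) (W j @^-1` B j).
  apply/seteqP; split => w Bw j; first by move=> _; exact: Bw.
  move=> _; case: (ltnP j k) => [jk|/Bk->//]; apply: Bw.
  by rewrite /= !inE/= mem_iota.
rewrite iidW.1// -(big_mkord xpredT (fun j => P (W j @^-1` B j))).
apply: perm_big; apply: uniq_perm; rewrite ?iota_uniq ?fset_uniq// => j.
by rewrite /index_iota subn0 !inE/=.
Qed.

Lemma rest_cylinders_setI r : setI_closed (rest_cylinders r).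
Proof.
move=> _ _ [D1 [B1 [sD1 [mB1 [k1 B1k]] B1r ->]]] [D2 [B2 [sD2 [mB2 [k2 B2k]]
  B2r ->]]].
exists (D1 `&` D2), (fun j => B1 j `&` B2 j); split.
- exact: (@measurableI _ (g_sigma_algebraType design_gen)).
- split=> [j|]; first exact: measurableI.
  by exists (maxn k1 k2) => j; rewrite geq_max => /andP[k1j k2j]; rewrite B1k//
    B2k// setTI.
- by rewrite B1r B2r setTI.
- rewrite setIACA; congr (_ `&` _); apply/seteqP; split =>
    [w [B1w B2w] j _|w Bw].
    by split; [exact: B1w|exact: B2w].
  by split => j _; have [] := Bw j I.
Qed.

Lemma rest_cylindersT r : rest_cylinders r setT.
Proof.
exists setT, (fun=> setT); split => //.
- exact: (@measurableT _ (g_sigma_algebraType design_gen)).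
- by split => //; exists 0%N.
- by rewrite setTI; apply/seteqP; split.
Qed.

Lemma rest_cylinders_gen r : rest_gen r `<=` rest_cylinders r.
Proof.
move=> X [gX|[j /eqP jr [B mB <-]]].
  exists X, (fun=> setT); split=> //.
  - exact: sub_sigma_algebra.
  - by split => //; exists 0%N.
  - by apply/seteqP; split => // w [].
exists setT, (fun i => if i == j then B else setT); split.
- exact: (@measurableT _ (g_sigma_algebraType design_gen)).
- split=> [i|]; first by case: ifP.
  by exists j.+1 => i ji; rewrite gtn_eqF.
- by case: eqP => // rj; case: jr.
- rewrite !setTI; apply/seteqP; split => [w Bw i _|w /(_ j I)/=]; last
    by rewrite eqxx.
  by case: eqP => // ->.
Qed.

(** Uniqueness of measures on a pi-system: for fixed [B], both sides are finite measures in [E] that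
    agree on [rest_cylinders r]. *)
Lemma noise_indep_rest r (E : set T) (B : set R) :
  <<s rest_gen r >> E -> measurable B ->
  P (E `&` W r @^-1` B) = (P E * normal_prob 0 1 B)%E.
Proof.
move=> sE mB.
have mWB := measurable_preimage_noise r mB.
have -> : normal_prob 0 1 B = P (W r @^-1` B) by rewrite -(iidW.2 r).
pose p : {nonneg R} := NngNum (fine_ge0 (measure_ge0 P (W r @^-1` B))).
have pE : p%:num%:E = P (W r @^-1` B) by rewrite /= fineK// fin_num_measure.
have mQ : rest_cylinders r `<=` measurable.
  move=> _ [D [B' [sD [mB' _] _ ->]]]; apply: measurableI.
    exact: measurable_design_sigma.
  by apply: bigcapT_measurable => j; exact: measurable_preimage_noise.
have sQE : <<s rest_cylinders r >> E.
  by move: E sE; apply: sub_smallest2r;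
    [exact: smallest_sigma_algebra|exact: rest_cylinders_gen].
have uniq := @g_sigma_algebra_measure_unique _ R T (rest_cylinders r) mQ
  (fun=> setT) _ _ (mrestr P mWB) (mscale p P) (@rest_cylinders_setI r).
have mscaleE X : mscale p P X = (P X * P (W r @^-1` B))%E.
  by rewrite -pE muleC.
rewrite -mscaleE -[LHS]/(mrestr P mWB E); apply: uniq sQE => //.
- by move=> _; exact: rest_cylindersT.
- by apply/seteqP; split => // w _; exists 0%N.
- move=> _ [D [B' [sD [mB' [k B'k]] B'r ->]]].
  apply/esym; rewrite [LHS]mscaleE; apply/esym.
  rewrite -[LHS]/(P (D `&` \bigcap_j (W j @^-1` B' j) `&` W r @^-1` B)).
  (* The range is enlarged beyond [r], so that the product has an [r]-th factor. *)
  have kr := leq_maxl k r.+1;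
    have rk : (r < maxn k r.+1)%N by rewrite leq_max leqnn orbT.
  move: (maxn k r.+1) kr rk => l kl rl.
  have B'l j : (l <= j)%N -> B' j = setT by move=> lj; apply: B'k;
    exact: leq_trans lj.
  pose B'' j := if j == r then B else B' j.
  have -> : D `&` \bigcap_j (W j @^-1` B' j) `&` W r @^-1` B
      = D `&` \bigcap_j (W j @^-1` B'' j).
    rewrite -setIA; congr (_ `&` _); apply/seteqP; split =>
      [w [B'w Bw] j _|w B''w].
      by rewrite /B''; case: eqP => [->//|_]; exact: B'w.
    split=> [j _|].
      have := B''w j I; rewrite /B''.
      by case: eqP => [->|//]; rewrite B'r.
    by have := B''w r I; rewrite /B'' eqxx.
  rewrite (@design_noise_cylinderE D B' l)//
    (@design_noise_cylinderE D B'' l)//; last 2 first.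
  - by move=> j; rewrite /B''; case: ifP.
  - by move=> j lj; rewrite /B'' gtn_eqF ?B'l//; exact: leq_trans lj.
  rewrite [in LHS](bigD1 (Ordinal rl))//= [in RHS](bigD1 (Ordinal rl))//=.
  rewrite B'r preimage_setT probability_setT mul1e {1}/B'' eqxx.
  rewrite [LHS]muleA muleAC; congr (_ * _ * _)%E; apply: eq_bigr => j jr.
  rewrite /B'' ifF//; apply: contraNF jr => /eqP jr; apply/eqP/val_inj.
  exact: jr.
- by move=> _; rewrite -ge0_fin_numE// fin_num_measure.
Qed.

End ExcludedNoise.

(** * Change of signal *)

Section Records.
Context {R : realType} {n : nat}.

(* [record R n] is not a [measurableType], as ['I_n] need not be inhabited. *)
Lemma measurable_record d (T : measurableType d) (X : T -> record R n) :
  (forall j, measurable_fun setT (fun w => (X w j).1.1)) ->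
  (forall j (B : set 'I_n), measurable ((fun w => (X w j).1.2) @^-1` B)) ->
  (forall j, measurable_fun setT (fun w => (X w j).2)) ->
  forall E, @record_sigma R n E -> measurable (X @^-1` E).
Proof.
move=> mY mA mG.
apply: smallest_sub.
  split=> [|E mE|E mE].
  - by rewrite /= preimage_set0.
  - by rewrite /= setTD preimage_setC; exact: measurableC.
  - by rewrite /= preimage_bigcup; exact: bigcupT_measurable.
move=> _ [j _ [[[B mB <-]|[B mB <-]]|[B mB <-]]] /=; rewrite setTI.
- by rewrite -[X in measurable X]setTI; exact: mY.
- exact: mA.
- by rewrite -[X in measurable X]setTI; exact: mG.
Qed.

(** The signal may depend on the index, to cover truncated signals, and the noise is an arbitrary
    sequence, so that one coordinate can be replaced. *)
Definition noisy_record (s : nat -> 'I_n -> R) (a : nat -> 'I_n)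
    (g v : nat -> R) : record R n :=
  fun j => (s j (a j) + g j `^ (- 2^-1) * v j, a j, g j).

Lemma measurable_noisy_record d (T : measurableType d) (s : nat -> 'I_n -> R)
    (a : nat -> T -> 'I_n) (g v : nat -> T -> R) :
  (forall j (B : set 'I_n), measurable (a j @^-1` B)) ->
  (forall j, measurable_fun setT (g j)) ->
  (forall j, measurable_fun setT (v j)) ->
  forall E, @record_sigma R n E ->
  measurable ((fun w => noisy_record s (a ^~ w) (g ^~ w) (v ^~ w)) @^-1` E).
Proof.
move=> ma mg mv; apply: measurable_record => //= j.
apply: measurable_funD.
- by move=> _ B mB;
    rewrite setTI -[X in measurable X]/(a j @^-1` (s j @^-1` B)).
- apply: measurable_funM => //.
  by apply: (measurableT_comp (@measurable_powR R _)).
Qed.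

End Records.

(** * Girsanov identity for finitely many records *)

Section ChangeOfSignal.
Context d (T : measurableType d) (R : realType) (P : probability T R).
Context (n : nat) (W G : nat -> {RV P >-> R}) (A : nat -> T -> 'I_n).
Variable s : 'I_n -> R.
Hypothesis mA : forall j i, measurable (A j @^-1` [set i]).
Hypothesis G_gt0 : forall j w, 0 < G j w.
Hypothesis iidW : iid_standard_normal W.
Hypothesis indepAGW : forall E F : set T,
  design_sigma A G E -> noise_sigma W F -> P (E `&` F) = (P E * P F)%E.

(** Interpolates between the null signal, at [k = 0], and [s], by switching the signal on in one
    record at a time. *)
Definition truncated_signal (k j : nat) (i : 'I_n) : R :=
  if (j < k)%N then s i else 0.

Definition truncated_obs (k : nat) (w : T) : record R n :=
  noisy_record (truncated_signal k) (A ^~ w) (G ^~ w) (W ^~ w).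

(* Adding the signal to the j-th observation amounts to translating its noise by
   this amount. *)
Definition noise_shift (j : nat) (w : T) : R := s (A j w) * G j w `^ 2^-1.

(** Log-likelihood ratio of the signal against the null signal, in terms of the noise: with shift
    [h], a record contributes [((W + h) ^+ 2 - W ^+ 2) / 2]. *)
Definition loglik (k : nat) (w : T) : R :=
  \sum_(j < k) (noise_shift j w * W j w + noise_shift j w ^+ 2 / 2).

Local Notation TF r := (g_sigma_algebraType (rest_gen W G A r)).

Lemma measurable_loc_TF r j (B : set 'I_n) :
  measurable (A j @^-1` B : set (TF r)).
Proof.
apply: sub_sigma_algebra; left; exists j => //; left.
by exists B => //; rewrite setTI.
Qed.

Lemma measurable_precision_TF r j : measurable_fun setT (G j : TF r -> R).
Proof.
move=> _ B mB; apply: sub_sigma_algebra; left; exists j => //; right.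
by exists B.
Qed.

Lemma measurable_noise_TF r j : j != r -> measurable_fun setT (W j : TF r -> R).
Proof.
by move=> jr _ B mB; apply: sub_sigma_algebra; right; exists j => //; exists B.
Qed.

Lemma measurable_shift_TF r j : measurable_fun setT (noise_shift j : TF r -> R).
Proof.
apply: measurable_funM.
- move=> _ B mB; rewrite setTI -[X in measurable X]/(A j @^-1` (s @^-1` B)).
  exact: measurable_loc_TF.
- apply: (measurableT_comp (@measurable_powR R _)).
  exact: measurable_precision_TF.
Qed.

Lemma measurable_loglik_TF r : measurable_fun setT (loglik r : TF r -> R).
Proof.
apply: measurable_sum => j; apply: measurable_funD.
- apply: measurable_funM; first exact: measurable_shift_TF.
  by apply: measurable_noise_TF; rewrite ltn_eqF.
- apply: measurable_funM => //; apply: measurable_funX.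
  exact: measurable_shift_TF.
Qed.

Lemma measurable_truncated_obs k E : @record_sigma R n E ->
  measurable (truncated_obs k @^-1` E).
Proof.
apply: measurable_noisy_record => //.
by move=> j B; exact: (measurable_preimage_loc mA).
Qed.

(** With all but the [r]-th noise frozen, translating that noise by [noise_shift r] switches the
    signal on in record [r]; the Gaussian weight is the factor that [expR (- loglik r.+1)] gains
    over [expR (- loglik r)]. *)
Lemma integral_truncated_obsS r E : @record_sigma R n E ->
  (\int[P]_w (\1_E (truncated_obs r w) * expR (- loglik r w))%:E =
   \int[P]_w (\1_E (truncated_obs r.+1 w) * expR (- loglik r.+1 w))%:E)%E.
Proof.
move=> sE; apply/esym.
pose rec (x : TF r * R) : record R n :=
  noisy_record (truncated_signal r) (A ^~ x.1) (G ^~ x.1)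
    (fun j => if j == r then x.2 else W j x.1).
pose f (x : TF r * R) : \bar R := (\1_E (rec x) * expR (- loglik r x.1))%:E.
have mrec : measurable (rec @^-1` E).
  apply: measurable_noisy_record sE => [j B|j|j].
  - rewrite -[X in measurable X]/(fst @^-1` (A j @^-1` B)).
    rewrite -[X in measurable X]setTI; apply: measurable_fst => //.
    exact: measurable_loc_TF.
  - by apply: measurableT_comp => //; exact: measurable_precision_TF.
  - case: eqP => [_|/eqP jr]; first exact: measurable_snd.
    by apply: measurableT_comp => //; exact: measurable_noise_TF.
have mf : measurable_fun setT f.
  apply/measurable_EFinP; apply: measurable_funM.
    have -> : (fun x => \1_E (rec x)) = \1_(rec @^-1` E) :> (_ -> R) by [].
    exact: measurable_indic.
  apply: measurableT_comp => //; apply: measurableT_comp => //.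
  by apply: measurableT_comp => //; exact: measurable_loglik_TF.
have f0 x : (0 <= f x)%E by rewrite lee_fin mulr_ge0 ?expR_ge0// indicE.
have recW w : rec (w, W r w) = truncated_obs r w.
  apply/funext => j; rewrite /rec /truncated_obs /noisy_record/=.
  by case: eqP => // ->.
have recS w : rec (w, W r w + noise_shift r w) = truncated_obs r.+1 w.
  apply/funext => j; rewrite /rec /truncated_obs /noisy_record/=.
  rewrite /truncated_signal ltnS [(j <= r)%N]leq_eqVlt.
  case: (eqVneq j r) => [->|//]; rewrite ltnn /= add0r mulrDr /noise_shift.
  (* The two powers of the precision cancel, leaving exactly the signal. *)
  rewrite [_ * (s _ * _)]mulrCA -powRD ?addNr ?powRr0 ?mulr1 1?addrC//.
  by rewrite (gt_eqF (G_gt0 _ _)) implybT.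
have := ge0_integral_indep_shift (measurable_rest_gen mA (r := r))
  (measurable_funP (W r)) (noise_indep_rest mA iidW indepAGW (r := r)) mf f0
  (@measurable_shift_TF r r).
rewrite /f; under eq_integral do rewrite recS.
under [X in _ = X -> _]eq_integral do rewrite recW.
move=> <-; apply: eq_integral => w _; rewrite -EFinM -mulrA -expRD.
by congr (_ * expR _)%:E; rewrite /loglik big_ord_recr/=; lra.
Qed.

Lemma integral_truncated_obs k E : @record_sigma R n E ->
  (\int[P]_w (\1_E (truncated_obs k w) * expR (- loglik k w))%:E
    = P (truncated_obs 0 @^-1` E))%E.
Proof.
move=> sE; elim: k => [|k <-]; last by rewrite [RHS]integral_truncated_obsS.
have m0 := measurable_truncated_obs 0 sE.
rewrite -[X in P X]setIT -integral_indic//.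
by apply: eq_integral => w _; rewrite /loglik big_ord0 oppr0 expR0 mulr1.
Qed.

End ChangeOfSignal.

(** * Divergence of one signal from the null signal *)

Section Divergence.
Context d (T : measurableType d) (R : realType) (P : probability T R).
Context (n : nat) (W G : nat -> {RV P >-> R}) (A : nat -> T -> 'I_n).
Variable s : 'I_n -> R.
Hypothesis mA : forall j i, measurable (A j @^-1` [set i]).
Hypothesis G_gt0 : forall j w, 0 < G j w.
Hypothesis iidW : iid_standard_normal W.
Hypothesis indepAGW : forall E F : set T,
  design_sigma A G E -> noise_sigma W F -> P (E `&` F) = (P E * P F)%E.
Hypothesis iG : forall j, P.-integrable setT (fun w => (G j w)%:E).

Local Notation noise_shift := (noise_shift G A s).
Local Notation loglik := (loglik W G A s).
Local Notation truncated_obs := (truncated_obs W G A s).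

Lemma shift_sqr j w : noise_shift j w ^+ 2 = s (A j w) ^+ 2 * G j w.
Proof.
rewrite /noise_shift exprMn -[X in _ * X]powR_mulrn ?powR_ge0// -powRrM.
by rewrite mulVf ?pnatr_eq0// powRr1// ltW.
Qed.

Lemma measurable_shift j : measurable_fun setT (noise_shift j).
Proof.
apply: measurable_funM.
- move=> _ B mB; rewrite setTI -[X in measurable X]/(A j @^-1` (s @^-1` B)).
  exact: (measurable_preimage_loc mA).
- by apply: (measurableT_comp (@measurable_powR R _)).
Qed.

(** A signal on finitely many locations is bounded, so the squared shift is at most a constant times
    the precision. *)
Lemma integrable_shift_sqr j : P.-integrable setT (fun w =>
  (noise_shift j w ^+ 2 / 2)%:E).
Proof.
pose M := \sum_i s i ^+ 2.
apply: (le_integrable _ _ _ (@integrableZl _ _ _ P _ measurableT M _ (iG j)))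
  => //.
  apply/measurable_EFinP; apply: measurable_funM => //; apply: measurable_funX.
  exact: measurable_shift.
move=> w _ /=; rewrite lee_fin shift_sqr.
have G0 : 0 <= G j w by rewrite ltW.
have sM : s (A j w) ^+ 2 <= M.
  by rewrite /M (bigD1 (A j w))//= lerDl sumr_ge0// => i _; exact: sqr_ge0.
have s0 := sqr_ge0 (s (A j w)).
rewrite [leLHS]ger0_norm ?divr_ge0 ?(mulr_ge0 s0 G0)//.
rewrite [leRHS]ger0_norm ?(mulr_ge0 (le_trans s0 sM))//.
have : s (A j w) ^+ 2 * G j w <= M * G j w by rewrite ler_wpM2r.
by have := mulr_ge0 s0 G0; lra.
Qed.

(** Domination: [|h| <= 1 + h ^+ 2 / 2]. *)
Lemma integrable_shift j : P.-integrable setT (fun w => (noise_shift j w)%:E).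
Proof.
have i1 : P.-integrable setT (fun w => 1%:E + (noise_shift j w ^+ 2 / 2)%:E)%E.
  apply: integrableD => //; first exact: finite_measure_integrable_cst.
  exact: integrable_shift_sqr.
apply: (le_integrable _ _ _ i1) => //.
  by apply/measurable_EFinP; exact: measurable_shift.
move=> w _ /=; rewrite lee_fin [leRHS]ger0_norm; last first.
  by have := sqr_ge0 (noise_shift j w); lra.
rewrite ler_norml; have := sqr_ge0 (noise_shift j w + 1);
  have := sqr_ge0 (noise_shift j w - 1).
by rewrite sqrrB sqrrD; lra.
Qed.

Lemma integrable_shiftW j : P.-integrable setT (fun w =>
  (noise_shift j w * W j w)%:E).
Proof.
apply: (integrable_indepM (measurable_rest_gen mA (r := j))
  (measurable_funP (W j))
  (noise_indep_rest mA iidW indepAGW (r := j))).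
  exact: measurable_shift_TF.
exact: integrable_shift.
Qed.

Lemma integral_shiftW j : (\int[P]_w (noise_shift j w * W j w)%:E = 0)%E.
Proof.
apply: (integral_indepM (measurable_rest_gen mA (r := j))
  (measurable_funP (W j))
  (noise_indep_rest mA iidW indepAGW (r := j))).
  exact: measurable_shift_TF.
exact: integrable_shift.
Qed.

Lemma loglikE k w : (loglik k w)%:E =
  (\sum_(j < k)
    ((noise_shift j w * W j w)%:E + (noise_shift j w ^+ 2 / 2)%:E))%E.
Proof. by rewrite -sumEFin. Qed.

Lemma integrable_loglik k : P.-integrable setT (fun w => (loglik k w)%:E).
Proof.
rewrite (_ : (fun w => _) = (fun w => \sum_(j < k)
    ((noise_shift j w * W j w)%:E + (noise_shift j w ^+ 2 / 2)%:E))%E); last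
      first.
  by apply/funext => w; exact: loglikE.
apply: integrable_sum => // j _; apply: integrableD => //.
  exact: integrable_shiftW.
exact: integrable_shift_sqr.
Qed.

(** The terms linear in the noise have mean zero, the shift being a function of the design. *)
Lemma integral_loglik k : (\int[P]_w (loglik k w)%:E
  = \sum_(j < k) \int[P]_w (noise_shift j w ^+ 2 / 2)%:E)%E.
Proof.
under eq_integral do rewrite loglikE.
rewrite integral_sum//; last first.
  move=> j; apply: integrableD => //; first exact: integrable_shiftW.
  exact: integrable_shift_sqr.
apply: eq_bigr => j _; rewrite integralD//.
- by rewrite integral_shiftW add0e.
- exact: integrable_shiftW.
- exact: integrable_shift_sqr.
Qed.

(* [x <= expR x - 1] with [x = a 1_E - loglik k]: a Donsker-Varadhan bound in
   which no logarithm of the moment generating function is needed. *)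
Lemma truncated_divergence k E (a : R) : 0 <= a -> @record_sigma R n E ->
  (a%:E * P (truncated_obs k @^-1` E) <=
   \sum_(j < k) \int[P]_w (noise_shift j w ^+ 2 / 2)%:E
     + (expR a - 1)%:E * P (truncated_obs 0 @^-1` E))%E.
Proof.
move=> a0 sE.
have setTs : @record_sigma R n setT.
  by rewrite -setC0 -setTD; apply: sigma_algebraCD; exact: sigma_algebra0.
have mE := measurable_truncated_obs W G s mA k sE.
have mL : measurable_fun setT (fun w => expR (- loglik k w)).
  apply: measurableT_comp => //; apply: measurableT_comp => //.
  apply: (measurable_sigmaF (measurable_rest_gen (W := W) (G := G)
    mA (r := k))).
  exact: measurable_loglik_TF.
(* The Girsanov identity for the sure event. *)
have int1 : (\int[P]_w (expR (- loglik k w))%:E = 1)%E.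
  rewrite -(@probability_setT _ _ _ P) -(preimage_setT (truncated_obs 0)).
  rewrite -(integral_truncated_obs s mA G_gt0 iidW indepAGW k setTs).
  by apply: eq_integral => w _; rewrite indicE mem_set// mul1r.
have intE := integral_truncated_obs s mA G_gt0 iidW indepAGW k sE.
have m1 : measurable_fun setT (fun w => \1_E (truncated_obs k w) : R).
  rewrite (_ : (fun w => _) = \1_(truncated_obs k @^-1` E) :> (_ -> R))//.
have mE1 : measurable_fun setT
    (fun w => (\1_E (truncated_obs k w) * expR (- loglik k w))%:E).
  by apply/measurable_EFinP; exact: measurable_funM.
have i0 F w : 0 <= \1_F (truncated_obs k w) * expR (- loglik k w).
  by rewrite mulr_ge0 ?expR_ge0// indicE.
have iE : P.-integrable setT
    (fun w => (\1_E (truncated_obs k w) * expR (- loglik k w))%:E).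
  apply/integrableP; split=> //.
  under eq_integral do rewrite gee0_abs ?lee_fin//.
  by rewrite intE ltey_eq fin_num_measure//; exact: measurable_truncated_obs.
have iH : P.-integrable setT (fun w => (expR (- loglik k w))%:E).
  apply/integrableP; split; first exact/measurable_EFinP.
  under eq_integral do rewrite gee0_abs ?lee_fin ?expR_ge0//.
  by rewrite int1 ltry.
have iI : P.-integrable setT (fun w => (\1_E (truncated_obs k w))%:E).
  exact: (integrable_indic P mE).
have b0 : 0 <= expR a - 1 by rewrite subr_ge0 -expR0 ler_expR.
(* The exponential of [a 1_E - loglik k] is expanded as [expR (- loglik k) + (expR a - 1) 1_E expR
   (- loglik k)]. *)
have : (\int[P]_w (a%:E * (\1_E (truncated_obs k w))%:E + 1%:E) <=
  \int[P]_w ((expR (- loglik k w))%:E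
    + ((expR a - 1)%:E * (\1_E (truncated_obs k w) * expR (- loglik k w))%:E
    + (loglik k w)%:E)))%E.
  apply: le_integral => //.
  - apply: integrableD => //; first exact: integrableZl.
    exact: finite_measure_integrable_cst.
  - apply: integrableD => //; apply: integrableD => //;
      first exact: integrableZl.
    exact: integrable_loglik.
  - move=> w _; rewrite -!EFinM -!EFinD lee_fin indicE.
    have := expR_ge1Dx (a * (truncated_obs k w \in E)%:R - loglik k w).
    case: (_ \in _); rewrite ?mulr1 ?mulr0 ?mul1r ?mul0r ?sub0r ?add0r; last
      lra.
    by rewrite expRD; lra.
rewrite integralD//;
  [|exact: integrableZl|exact: finite_measure_integrable_cst].
rewrite integralZl// [X in (_ * X + _)%E](integral_indic P measurableT mE)
  setIT.
have -> : (\int[P]_w 1%:E = 1)%E by rewrite integral_cst// mul1e;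
  exact: probability_setT.
rewrite integralD//; last first.
  by apply: integrableD; [|exact: integrableZl|exact: integrable_loglik].
rewrite integralD//; [|exact: integrableZl|exact: integrable_loglik].
rewrite integralZl// intE integral_loglik int1.
rewrite [X in (X <= _)%E -> _]addeC leeD2lE//.
by rewrite [X in (_ <= X)%E -> _]addeC.
Qed.

(* The Kullback-Leibler divergence of the law of the records under the signal
   [s] from their law under the null signal. *)
Definition divergence : \bar R :=
  (\int[P]_w \sum_(0 <= j <oo) (noise_shift j w ^+ 2 / 2)%:E)%E.

(** Series and integral of nonnegative terms commute, which gives a bound uniform in [k]. *)
Lemma sum_divergence k :
  (\sum_(j < k) \int[P]_w (noise_shift j w ^+ 2 / 2)%:E <= divergence)%E.
Proof.
rewrite /divergence integral_nneseries//.
- rewrite -(big_mkord xpredT (fun j =>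
    \int[P]_w (noise_shift j w ^+ 2 / 2)%:E)%E).
  by apply: nneseries_lim_ge => j _ _; apply: integral_ge0 => w _;
    rewrite lee_fin divr_ge0// sqr_ge0.
- by move=> j; exact: measurable_int (integrable_shift_sqr j).
- by move=> j w _; rewrite lee_fin divr_ge0// sqr_ge0.
Qed.

End Divergence.

(** * From finitely many records to all of them *)

Section CylinderApproximation.
Context {R : realType} {n : nat}.
Implicit Types E F : set (record R n).

Definition depends_on_first (k : nat) E : Prop :=
  forall o o' : record R n, (forall j, (j < k)%N -> o j = o' j) -> E o -> E o'.

Lemma record_sigmaC E : record_sigma E -> record_sigma (~` E).
Proof. by move=> sE; rewrite -setTD; exact: sigma_algebraCD. Qed.

Lemma record_sigma_bigcup (E : nat -> set (record R n)) :
  (forall i, record_sigma (E i)) -> record_sigma (\bigcup_i E i).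
Proof. exact: sigma_algebra_bigcup. Qed.

Lemma record_sigmaU E F : record_sigma E -> record_sigma F ->
  record_sigma (E `|` F).
Proof.
move=> sE sF; rewrite -bigcup2E; apply: record_sigma_bigcup => -[|[|i]]//=.
exact: sigma_algebra0.
Qed.

Lemma record_sigmaD E F : record_sigma E -> record_sigma F ->
  record_sigma (E `\` F).
Proof.
move=> sE sF; rewrite setDE -[E]setCK -setCU; apply: record_sigmaC.
by apply: record_sigmaU => //; exact: record_sigmaC.
Qed.

Lemma record_sigmaY E F : record_sigma E -> record_sigma F ->
  record_sigma (E `+` F).
Proof.
move=> sE sF; apply: record_sigmaU; exact: record_sigmaD.
Qed.

Context d (T : measurableType d) (P : probability T R).
(* Indexed by [bool] because one cylinder has to serve for both signals. *)
Variable X : bool -> T -> record R n.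
Hypothesis mX : forall b E, record_sigma E -> measurable (X b @^-1` E).

(** Measurability is part of the property, so that it is carried along the induction over
    [record_sigma]. *)
Definition approximable E : Prop := record_sigma E /\
  forall e : R, 0 < e -> exists k F, [/\ record_sigma F, depends_on_first k F
    & forall b, (P (X b @^-1` (E `+` F)) <= e%:E)%E].

Lemma approximable_cylinder k E : record_sigma E -> depends_on_first k E ->
  approximable E.
Proof.
move=> sE kE; split=> // e e0; exists k, E; split => // b.
by rewrite setYK preimage_set0 measure0 lee_fin ltW.
Qed.

Lemma approximableC E : approximable E -> approximable (~` E).
Proof.
move=> [sE aE]; split; first exact: record_sigmaC.
move=> e /aE[k [F [sF kF PF]]]; exists k, (~` F); split.
- exact: (record_sigmaC sF).
- by move=> o o' oo' nF Fo; apply: nF; apply: kF Fo => j jk; rewrite oo'.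
- move=> b; apply: le_trans (PF b); apply: le_measure; rewrite ?inE.
  + by apply: mX; apply: record_sigmaY; exact: record_sigmaC.
  + by apply: mX; exact: record_sigmaY.
  + by move=> w /= [[nE /contrapT Fw]|[nF /contrapT Ew]]; [right|left].
Qed.

(** The symmetric difference of the unions lies in the union of the symmetric differences, each
    allowed half of the error. *)
Lemma approximableU E1 E2 : approximable E1 -> approximable E2 ->
  approximable (E1 `|` E2).
Proof.
move=> [sE1 aE1] [sE2 aE2]; split; first exact: record_sigmaU.
move=> e e0; have e20 : 0 < e / 2 by rewrite divr_gt0.
have [k1 [F1 [sF1 kF1 PF1]]] := aE1 _ e20.
have [k2 [F2 [sF2 kF2 PF2]]] := aE2 _ e20.
exists (maxn k1 k2), (F1 `|` F2); split; first exact: record_sigmaU.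
- move=> o o' oo' [F1o|F2o]; [left; apply: kF1 F1o|right; apply: kF2 F2o] =>
    j jk;
  by apply: oo'; rewrite leq_max jk ?orbT.
- move=> b; rewrite (splitr e) EFinD; apply: le_trans (leeD (PF1 b) (PF2 b)).
  have m1 : measurable (X b @^-1` (E1 `+` F1)) by apply: mX;
    exact: record_sigmaY.
  have m2 : measurable (X b @^-1` (E2 `+` F2)) by apply: mX;
    exact: record_sigmaY.
  apply: le_trans (measureU2 P m1 m2).
  apply: le_measure; rewrite ?inE; [|exact: measurableU|].
    by apply: mX; apply: record_sigmaY => //; exact: record_sigmaU.
  move=> w; rewrite /= /setY /= => -[[[E1w|E2w] /not_orP[nF1 nF2]]
    |[[F1w|F2w] /not_orP[nE1 nE2]]]; tauto.
Qed.

(** By continuity from above, a finite union misses at most [e / 2] of the countable one, and is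
    itself approximated within [e / 2]. *)
Lemma approximable_bigcup (E : nat -> set (record R n)) :
  (forall i, approximable (E i)) -> approximable (\bigcup_i E i).
Proof.
move=> aE; have sE i : record_sigma (E i) by case: (aE i).
have sU := record_sigma_bigcup sE; split=> // e e0.
pose F N := \big[setU/set0]_(i < N) E i.
have aF N : approximable (F N).
  rewrite /F; elim: N => [|N IH].
    by rewrite big_ord0; apply: (@approximable_cylinder 0);
      first exact: sigma_algebra0.
  by rewrite big_ord_recr/=; exact: approximableU.
have sF N : record_sigma (F N) by case: (aF N).
have e20 : 0 < e / 2 by rewrite divr_gt0.
have mD b N : measurable (X b @^-1` (\bigcup_i E i `\` F N)).
  by apply: mX; exact: record_sigmaD.
have decr b : nonincreasing_seq (fun N => X b @^-1` (\bigcup_i E i `\` F N)).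
  apply/nonincreasing_seqP => N; apply/subsetPset => w [Uw nF]; split=> // Fw.
  by apply: nF; rewrite /F big_ord_recr/=; left.
have capD b : \bigcap_N (X b @^-1` (\bigcup_i E i `\` F N)) = set0.
  rewrite -subset0 => w Dw; have [[i _ Ei] _] := Dw 0%N I.
  have [_] := Dw i.+1 I; apply.
  by rewrite /F big_ord_recr/=; right.
have tail b : exists N0, forall N, (N0 <= N)%N ->
    (P (X b @^-1` (\bigcup_i E i `\` F N)) <= (e / 2)%:E)%E.
  have : (P \o (fun N => X b @^-1` (\bigcup_i E i `\` F N))) @ \oo --> P set0.
    rewrite -(capD b); apply: nonincreasing_cvg_mu => //.
    - by rewrite -ge0_fin_numE// fin_num_measure.
    - exact: bigcapT_measurable.
  rewrite measure0 => /fine_cvgP[_ /cvgrPdist_le/(_ _ e20)[N0 _ tail0]].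
  exists N0 => N N0N; have := tail0 N N0N.
  rewrite /= sub0r normrN ger0_norm ?fine_ge0// -lee_fin fineK//.
  exact: fin_num_measure.
have [N1 tail1] := tail true; have [N2 tail2] := tail false.
(* The larger rank serves both laws. *)
pose N := maxn N1 N2; have [_ /(_ _ e20)[k [C [sC kC PC]]]] := aF N.
exists k, C; split=> // b; rewrite (splitr e) EFinD.
have tailN : (P (X b @^-1` (\bigcup_i E i `\` F N)) <= (e / 2)%:E)%E.
  by case: b; [apply: tail1|apply: tail2]; rewrite leq_max leqnn ?orbT.
apply: le_trans (leeD tailN (PC b)).
have m2 : measurable (X b @^-1` (F N `+` C)) by apply: mX; exact: record_sigmaY.
apply: le_trans (measureU2 P (mD b N) m2).
apply: le_measure; rewrite ?inE; [|exact: measurableU|].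
  by apply: mX; exact: record_sigmaY.
have FU : F N `<=` \bigcup_i E i.
  by rewrite /F -bigcup_mkord => o [i _ Eo]; exists i.
move=> w; rewrite /= /setY /= => -[[Uw nC]|[Cw nU]].
- by have [Fw|nF] := pselect (F N (X b w)); [right; left|left].
- by right; right; split=> // /FU.
Qed.

(** Approximable events form a sigma-algebra containing the generators, each of which reads a single
    record. *)
Lemma approximable_record_sigma E : record_sigma E -> approximable E.
Proof.
move: E; apply: smallest_sub.
  split=> [|E aE|E aE].
  - by apply: (@approximable_cylinder 0); first exact: sigma_algebra0.
  - by rewrite setTD; exact: approximableC.
  - exact: approximable_bigcup.
move=> E gE; have [j jE] : exists j, depends_on_first j.+1 E.
  case: gE => j _ [[[B _ <-]|[B _ <-]]|[B _ <-]]; exists j =>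
    o o' oo' [_ /= Bo];
  by split=> //=; rewrite -(oo' j).
by apply: approximable_cylinder jE; exact: sub_sigma_algebra.
Qed.

End CylinderApproximation.

(** * Divergence bound for the full sequence of records *)

Section DivergenceBound.
Context d (T : measurableType d) (R : realType) (P : probability T R).
Context (n : nat) (W G : nat -> {RV P >-> R}) (A : nat -> T -> 'I_n).
Variable s : 'I_n -> R.
Hypothesis mA : forall j i, measurable (A j @^-1` [set i]).
Hypothesis G_gt0 : forall j w, 0 < G j w.
Hypothesis iidW : iid_standard_normal W.
Hypothesis indepAGW : forall E F : set T,
  design_sigma A G E -> noise_sigma W F -> P (E `&` F) = (P E * P F)%E.
Hypothesis iG : forall j, P.-integrable setT (fun w => (G j w)%:E).

Definition signal_obs (t : 'I_n -> R) (w : T) : record R n :=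
  noisy_record (fun=> t) (A ^~ w) (G ^~ w) (W ^~ w).

Lemma measurable_signal_obs t E : @record_sigma R n E ->
  measurable (signal_obs t @^-1` E).
Proof.
apply: measurable_noisy_record => //.
by move=> j B; exact: (measurable_preimage_loc mA).
Qed.

(** [E] is replaced by a nearby event on finitely many records, to which the truncated bound
    applies; the loss is arbitrarily small. *)
Lemma signal_obs_divergence E (a : R) : 0 <= a -> @record_sigma R n E ->
  (a%:E * P (signal_obs s @^-1` E) <=
   divergence G A s + (expR a - 1)%:E * P (signal_obs (fun=> 0%R) @^-1` E))%E.
Proof.
move=> a0 sE.
have b0 : 0 <= expR a - 1 by rewrite subr_ge0 -expR0 ler_expR.
pose X (b : bool) := if b then signal_obs s else signal_obs (fun=> 0).
have mX b F : record_sigma F -> measurable (X b @^-1` F).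
  by case: b; exact: measurable_signal_obs.
have cap (Y : T -> record R n) F F' (e : R) :
    (forall F0, record_sigma F0 -> measurable (Y @^-1` F0)) ->
    record_sigma F -> record_sigma F' ->
    (P (Y @^-1` (F `+` F')) <= e%:E)%E ->
    (P (Y @^-1` F) <= P (Y @^-1` F') + e%:E)%E.
  move=> mY sF sF' Pe; have mF' := mY _ sF'.
  have mD : measurable (Y @^-1` (F `+` F')) by apply: mY; exact: record_sigmaY.
  apply: le_trans (leeD2l (P (Y @^-1` F')) Pe).
  apply: le_trans (measureU2 P mF' mD).
  apply: le_measure; rewrite ?inE; [exact: mY|exact: measurableU|].
  by move=> w Fw; have [|nF'] := pselect (F' (Y w)); [left|right; left].
apply/lee_addgt0Pr => e e0.
(* The total loss is [(a + (expR a - 1)) * e'], at most [e]; the final 1 keeps the denominator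
   positive. *)
pose e' := e / (a + (expR a - 1) + 1).
have e'0 : 0 < e' by rewrite divr_gt0//; lra.
have [_ /(_ _ e'0)[k [F [sF kF PF]]]] := approximable_record_sigma P mX sE.
(* An event on the first [k] records cannot see the truncation at [k]. *)
have XF : signal_obs s @^-1` F = truncated_obs W G A s k @^-1` F.
  apply/seteqP; split => w; apply: kF => j jk;
  by rewrite /signal_obs /truncated_obs /noisy_record /truncated_signal jk.
have X0 : signal_obs (fun=> 0) = truncated_obs W G A s 0 by [].
have Es := cap _ _ _ _ (mX true) sE sF (PF true).
have E0 : (P (signal_obs (fun=> 0%R) @^-1` F)
    <= P (signal_obs (fun=> 0%R) @^-1` E) + e'%:E)%E.
  by apply: cap (mX false) sF sE _; rewrite setYC; exact: (PF false).
have div := truncated_divergence s mA G_gt0 iidW indepAGW iG k a0 sF.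
have sumdiv := sum_divergence s mA G_gt0 iG k.
rewrite -X0 -XF in div.
apply: (@le_trans _ _ (a%:E * (P (signal_obs s @^-1` F) + e'%:E))%E).
  by rewrite lee_wpmul2l// lee_fin.
rewrite ge0_muleDr//; last by rewrite lee_fin ltW.
apply: (@le_trans _ _ (divergence G A s + (expR a - 1)%:E *
    (P (signal_obs (fun=> 0%R) @^-1` E) + e'%:E) + a%:E * e'%:E)%E).
  apply: leeD => //; apply: le_trans div _; apply: leeD => //.
  by rewrite lee_wpmul2l// lee_fin.
rewrite ge0_muleDr//; last by rewrite lee_fin ltW.
rewrite -!EFinM; move: (divergence G A s) ((expR a - 1)%:E * P _)%E => D q.
rewrite -!addeA -EFinD; do 2 apply: leeD2l; rewrite lee_fin /e'.
rewrite -mulrDl mulrA ler_pdivrMr; last lra.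
by nra.
Qed.

End DivergenceBound.

(** * Summation over the class *)

(** The fibres are disjoint, so their indicators add up to at most 1 pointwise. *)
Lemma sum_prob_fiber_le1 d (T : measurableType d) (R : realType)
    (P : probability T R) (I : finType) (g : T -> I) (C : {set I}) :
  (forall i, measurable (g @^-1` [set i])) ->
  (\sum_(i in C) P (g @^-1` [set i]) <= 1)%E.
Proof.
move=> mg; rewrite -big_enum/=.
under eq_bigr do rewrite -[X in P X]setIT -integral_indic//.
rewrite -ge0_integral_sum//; last first.
  by move=> i; apply/measurable_EFinP.
have -> : (1 = \int[P]_w cst 1 w)%E.
  by rewrite integral_cst// mul1e; exact/esym/probability_setT.
apply: ge0_le_integral => //.
- by move=> w _; apply: sume_ge0 => i _; rewrite lee_fin.
- by apply: emeasurable_sum => i; exact/measurable_EFinP.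
move=> w _; rewrite sumEFin lee_fin big_enum/=.
apply: (@le_trans _ _ (\sum_i \1_(g @^-1` [set i]) w)).
  by rewrite [leRHS](bigID (mem C))/= lerDl sumr_ge0.
rewrite (bigD1 (g w))//= indicE mem_set// big1 ?addr0// => i ig.
rewrite indicE memNset//= => gi; case/eqP: ig; exact/esym.
Qed.

(** Symmetry is stated in [rat]; it passes to [R] through an identity between natural numbers. *)
Lemma card_symmetric_class (R : realType) n s (C : {set {set 'I_n}})
    (i : 'I_n) :
  symmetric_class s C ->
  #|[set S in C | i \in S]%SET|%:R = #|C|%:R * (s%:R / n%:R) :> R.
Proof.
move=> [C0 _ /(_ i)]; rewrite /unif_prob => unif.
have CQ : #|C|%:R != 0 :> rat by rewrite pnatr_eq0 -lt0n.
have n0 : (0 < n)%N := leq_ltn_trans (leq0n i) (ltn_ord i).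
have nQ : n%:R != 0 :> rat by rewrite pnatr_eq0 -lt0n.
have nR : n%:R != 0 :> R by rewrite pnatr_eq0 -lt0n.
have /eqP : (#|[set S in C | i \in S]%SET| * n)%:R = (#|C| * s)%:R :> rat.
  rewrite !natrM; apply: (mulIf (invr_neq0 CQ)).
  rewrite mulrAC unif divfK// mulrAC divff// mul1r.
  by [].
rewrite eqr_nat => /eqP cn; apply: (mulIf nR); rewrite -natrM cn natrM.
by rewrite mulrA divfK.
Qed.

Section ClassDivergence.
Context d (T : measurableType d) (R : realType) (P : probability T R).
Context (n s : nat) (G : nat -> {RV P >-> R}) (A : nat -> T -> 'I_n).
Variables (C : {set {set 'I_n}}) (mu : R).
Hypothesis symC : symmetric_class s C.
Hypothesis mA : forall j i, measurable (A j @^-1` [set i]).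
Hypothesis G_gt0 : forall j w, 0 < G j w.

(** Only the sets containing the measured location contribute, and by symmetry their number is the
    same for every location. *)
Lemma sum_shift_sqr j w :
  \sum_(S in C) noise_shift G A (signal mu S) j w ^+ 2 / 2 =
  (mu ^+ 2 * #|C|%:R * (s%:R / n%:R) / 2) * G j w.
Proof.
rewrite (eq_bigr (fun S : {set 'I_n} =>
    mu ^+ 2 / 2 * G j w * (A j w \in S)%:R)); last first.
  move=> S _; rewrite shift_sqr// /signal; case: (A j w \in S);
    first by rewrite mulr1 mulrAC.
  by rewrite expr0n/= !mul0r mulr0.
rewrite -mulr_sumr.
have -> : \sum_(S in C) (A j w \in S)%:R = #|C|%:R * (s%:R / n%:R) :> R.
  rewrite -(card_symmetric_class R (A j w) symC) -sum1_card natr_sum.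
  rewrite [RHS](eq_bigl (fun S => (S \in C) && (A j w \in S))); last first.
    by move=> S; rewrite inE.
  by rewrite big_mkcondr/=; apply: eq_bigr => S _; case: ifP.
by move: (s%:R / n%:R) => x; field.
Qed.

(** The pointwise sum no longer depends on the locations, so only the expected total precision
    remains. *)
Lemma sum_class_divergence :
  (\sum_(S in C) divergence G A (signal mu S) =
   (mu ^+ 2 * #|C|%:R * (s%:R / n%:R) / 2)%:E
     * \int[P]_w \sum_(0 <= j <oo) (G j w)%:E)%E.
Proof.
have sq0 S j w : (0 <= (noise_shift G A (signal mu S) j w ^+ 2 / 2)%:E)%E.
  by rewrite lee_fin divr_ge0// sqr_ge0.
have G0 j w : (0 <= (G j w)%:E)%E by rewrite lee_fin ltW.
have ms S j : measurable_fun setT (fun w => (noise_shift G A (signal mu S)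
  j w ^+ 2 / 2)%:E).
  apply/measurable_EFinP; apply: measurable_funM => //; apply: measurable_funX.
  exact: (measurable_shift G).
have mseries (h : nat -> T -> \bar R) : (forall j, measurable_fun setT (h j)) ->
    (forall j w, 0 <= h j w)%E ->
    measurable_fun setT (fun w => \sum_(0 <= j <oo) h j w)%E.
  move=> mh h0.
  exact: (ge0_emeasurable_sum (P := xpredT) (fun j w _ _ => h0 j w) (fun j _ =>
    mh j)).
rewrite -big_enum/= -ge0_integral_sum//; last 2 first.
- by move=> S; apply: (mseries (fun j w => (noise_shift G A (signal mu S)
    j w ^+ 2 / 2)%:E)).

- by move=> S w _; apply: nneseries_ge0 => j _ _; exact: sq0.
rewrite -ge0_integralZl//; last 3 first.
- by apply: (mseries (fun j w => (G j w)%:E)) => // j; exact/measurable_EFinP.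
- by move=> w _; apply: nneseries_ge0 => j _ _; exact: G0.
- move: (mu ^+ 2) (sqr_ge0 mu) => x x0.
  by rewrite lee_fin !mulr_ge0 // invr_ge0.
apply: eq_integral => w _; rewrite -nneseries_sum// -nneseriesZl//.
apply: eq_eseriesr => j _; rewrite sumEFin big_enum/= sum_shift_sqr EFinM.
by [].
Qed.

End ClassDivergence.

(** Each precision is one term of a nonnegative series of finite expectation. *)
Lemma design_precision_integrable d (T : measurableType d) (R : realType)
    (P : probability T R) (G : nat -> {RV P >-> R}) (m : R) :
  (forall j w, 0 < G j w) ->
  (\int[P]_w (\sum_(0 <= j <oo) (G j w)%:E) <= m%:E)%E ->
  forall j, P.-integrable setT (fun w => (G j w)%:E).
Proof.
move=> G_gt0 budget j.
have G0 i w : (0 <= (G i w)%:E)%E by rewrite lee_fin ltW.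
have mG i : measurable_fun setT (fun w => (G i w)%:E) by exact/measurable_EFinP.
apply/integrableP; split => //.
under eq_integral do rewrite gee0_abs//.
apply: le_lt_trans (ltry m); apply: le_trans budget.
rewrite integral_nneseries//.
apply: le_trans (nneseries_lim_ge j.+1 _) => [|i _ _]; last exact: integral_ge0.
by rewrite big_nat_recr//= leeDr// sume_ge0// => i _; exact: integral_ge0.
Qed.

(** * Comparison of the summed bounds *)

Theorem proposition10 (R : realType) (n s : nat) (C : {set {set 'I_n}})
    (m mu eps : R) :
  (1 <= s)%N -> symmetric_class s C ->
  0 < m -> 0 < mu -> 0 < eps ->
  1 + Num.sqrt 2 <= (1 - 2 * eps) * ln (#|C|%:R - 1) ->
  mu ^+ 2 <= (1 - 2 * eps) * (n%:R / (2 * s%:R * m)) * ln (#|C|%:R - 1) ->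
  forall (d : measure_display) (T : measurableType d) (P : probability T R)
    (W : nat -> {RV P >-> R}) (A : nat -> T -> 'I_n)
    (G : nat -> {RV P >-> R}) (Shat : record R n -> {set 'I_n}),
  iid_standard_normal W ->
  nonadaptive_design m W A G ->
  estimator Shat ->
  ~ (forall S : {set 'I_n}, S \in C ->
       (error_prob mu W A G Shat S <= eps%:E)%E).
Proof.
move=> s1 symC m0 mu0 eps0 hL hmu d T P W A G Shat iidW.
move=> [mA G_gt0 indepAGW budget] mS err.
have iG := design_precision_integrable G_gt0 budget.
set N : R := #|C|%:R in hL hmu; set L := ln (N - 1) in hL hmu.
(* Yields [2 <= (1 - 2 * eps) * L]. *)
have sqrt2 : 1 <= Num.sqrt (2 : R) by rewrite -[leLHS]sqrtr1 ler_sqrt// ler1n.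
have C2 : (2 <= #|C|)%N.
  rewrite ltnNge; apply/negP => C1.
  (* For a single set the logarithm takes its default value [ln 0 = 0], against [hL]. *)
  have N1 : N - 1 = 0.
    by apply/eqP;
      rewrite subr_eq0 pnatr_eq1 eqn_leq C1 (symmetric_class_neq0 symC).
  by move: hL; rewrite /L N1 ln0//; lra.
have N2 : 2 <= N by rewrite ler_nat.
have L0 : 0 <= L by apply: ln_ge0; lra.
have expL : expR L = N - 1 by rewrite lnK// posrE; lra.
have n0 : (0 < n)%N.
  have [S SC] : exists S, S \in C by apply/card_gt0P; exact: ltnW.
  rewrite -(card_ord n); apply: leq_trans s1 _.
  by rewrite -(symmetric_class_card symC SC) max_card.
pose Y S := signal_obs W G A (signal mu S).
have mY t E : record_sigma E -> measurable (signal_obs W G A t @^-1` E).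
  exact: measurable_signal_obs.
have success S : S \in C ->
    ((1 - eps)%:E <= P (Y S @^-1` (Shat @^-1` [set S])))%E.
  move=> SC; have := err S SC; rewrite /error_prob.
  have -> : [set w | Shat (observation mu S W A G w) <> S]
      = ~` (Y S @^-1` (Shat @^-1` [set S])) by [].
  rewrite probability_setC; last by apply: mY; exact: mS.
  rewrite -[P (Y S @^-1` _)]fineK; last by apply: fin_num_measure; apply: mY;
    exact: mS.
  by rewrite -EFinB !lee_fin; lra.
pose Z := signal_obs W G A (fun=> 0).
(* The divergence bound with [a = L], for which [expR a - 1 = N - 2]. *)
have fano S : S \in C -> ((L * (1 - eps))%:E <= divergence G A (signal mu S) +
    (N - 2)%:E * P (Z @^-1` (Shat @^-1` [set S])))%E.
  move=> SC; have := signal_obs_divergence (signal mu S)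
    mA G_gt0 iidW indepAGW iG L0 (mS S).
  rewrite expL (_ : N - 1 - 1 = N - 2); last by lra.
  apply: le_trans.
  by rewrite EFinM lee_wpmul2l// ?lee_fin//; exact: success.
have sumfano : ((N * (L * (1 - eps)))%:E <=
    \sum_(S in C) divergence G A (signal mu S) + (N - 2)%:E)%E.
  have -> : ((N * (L * (1 - eps)))%:E = \sum_(S in C) (L * (1 - eps))%:E)%E.
    by rewrite sumEFin sumr_const mulr_natl.
  apply: (le_trans (lee_sum _ fano)).
  rewrite big_split/=; apply: leeD2l.
  rewrite -ge0_sume_distrr => [|S _]; last exact: measure_ge0.
  rewrite -[leRHS]mule1 lee_wpmul2l ?lee_fin//; first lra.
  (* Under the null signal the events [Shat = S] are the fibres of one map. *)
  apply: (sum_prob_fiber_le1 P (g := Shat \o Z)) => S.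
  exact: (mY (fun=> 0) _ (mS S)).
have sumdiv : (\sum_(S in C) divergence G A (signal mu S)
    <= (N * ((1 - 2 * eps) * L / 4))%:E)%E.
  rewrite (sum_class_divergence mu symC mA G_gt0).
  apply: (@le_trans _ _ ((mu ^+ 2 * N * (s%:R / n%:R) / 2)%:E * m%:E)%E).
    rewrite lee_wpmul2l// lee_fin.
    by move: (mu ^+ 2) (sqr_ge0 mu) => x x0; rewrite !mulr_ge0// invr_ge0.
  rewrite -EFinM lee_fin.
  have nR : 0 < n%:R :> R by rewrite ltr0n.
  have sR : 0 < s%:R :> R by rewrite ltr0n.
  have c0 : 0 <= N * (s%:R / n%:R) / 2 * m.
    by rewrite !mulr_ge0// ?invr_ge0// ltW.
  (* At the largest [mu ^+ 2] allowed by [hmu], the quantities [n], [s] and [m] cancel. *)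
  have -> : N * ((1 - 2 * eps) * L / 4) = (1 - 2 * eps)
    * (n%:R / (2 * s%:R * m))
      * L * (N * (s%:R / n%:R) / 2 * m).
    by field; rewrite !gt_eqF.
  by apply: le_trans (ler_wpM2r c0 hmu); rewrite !mulrA.
have : N * (L * (1 - eps)) <= N * ((1 - 2 * eps) * L / 4) + (N - 2).
  by rewrite -lee_fin EFinD; apply: le_trans sumfano _; exact: leeD.
apply/negP; rewrite -ltNge.
have epsL : 0 <= eps * L by rewrite mulr_ge0// ltW.
(* With [u = (1 - 2 * eps) * L], the right side is [u + eps * L], and [u >= 2]. Strictness comes
   afterwards from [N - 2 < N]. *)
have : (1 - 2 * eps) * L / 4 + 1 <= L * (1 - eps) by lra.
by move/(ler_wpM2l (le_trans (ler0n R 2) N2)); lra.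
Qed.
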